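(* Let $b\in\mathbb{C}$ and let $$\tilde T_4=4(T_2+b^2-1)\hat A-3(T_2+b^2)(T_2+b^2-2),$$ a fourth-order differential operator of the form $\partial_x^4-4\left(x+\frac1{x+b}\right)\partial_x^3+(\text{terms of order at most }2)$. Then the polynomials $\tilde h_{n+1}(x;b)$ satisfy $$\tilde T_4\,\tilde h_{n+1}=p_2(-2n)\,\tilde h_{n+1}=(b^2-2n)(b^2-2-2n)\,\tilde h_{n+1},\qquad n=0,1,2,\dots$$
   Context: $h_n(x)=\sum_{j=0}^{\lfloor n/2\rfloor}\frac{n!}{(n-2j)!\,j!}x^{n-2j}(-4)^{-j}$, $n\in\mathbb{N}_0$, are the monic Hermite polynomials. The differential operators are $T_2=\partial_x^2-2x\partial_x$, $U=\partial_x+b$, $\hat A=T_2+b^2-(x+b)^{-1}U$; products of operators denote composition. The polynomial $p_2$ is $p_2(T)=p_2(T;b)=(T+b^2)(T+b^2-2)$. The exceptional Krall polynomials are $$\tilde h_{n+1}(x;b)=(x+b)(\hat A h_n)(x)=(b^2-2n)(x+b)h_n(x)-b\,h_n(x)-n\,h_{n-1}(x),\quad n\in\mathbb{N}_0,$$ where $n\,h_{n-1}$ is $0$ when $n=0$. *)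

(* Defs.v *)
From HB Require Import structures.
From mathcomp Require Import all_boot all_order all_algebra.
From mathcomp Require Import reals complex ring.

Set Implicit Arguments.
Unset Strict Implicit.
Unset Printing Implicit Defensive.

Import GRing.Theory Num.Theory.
Local Open Scope ring_scope.
Local Open Scope quotient_scope.

(* F(x), the field of rational functions in one variable *)
Notation ratfun F := {fraction {poly F}}.

Definition ratpoly (F : fieldType) (p : {poly F}) : ratfun F :=
  FracField.tofrac p.
HB.instance Definition _ (F : fieldType) :=
  GRing.RMorphism.copy (@ratpoly F) (@FracField.tofrac {poly F}).
Definition ratC (F : fieldType) (c : F) : ratfun F := ratpoly c%:P.
Definition ratX (F : fieldType) : ratfun F := ratpoly 'X.
Arguments ratX {F}.

(* The derivation d/dx of F(x), by the quotient rule on a representative n / d;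
   it does not depend on the representative (rderiv_frac below). *)
Definition rderiv (F : fieldType) (f : ratfun F) : ratfun F :=
  let n := \n_(repr f) in let d := \d_(repr f) in
  ratpoly (n^`() * d - n * d^`()) / ratpoly (d ^+ 2).

(* Differential operators with rational coefficients are represented by their
   action on F(x).  This is faithful over a field of characteristic 0: there the
   coefficients are determined by the action.  The composition of operators is
   \o, and [*%R c] is the operator of multiplication by c. *)
Definition diffop_order_le (F : fieldType) (k : nat)
    (L : ratfun F -> ratfun F) : Prop :=
  exists a : 'I_k.+1 -> ratfun F,
    forall f, L f = \sum_(i < k.+1) a i * iter i (@rderiv F) f.

Section Krall.
Variable F : fieldType.
Implicit Types (b : F) (n : nat).

Definition hermite n : {poly F} :=
  \sum_(j < n./2.+1)
    (n`!%:R / ((n - 2 * j)`!%:R * j`!%:R) * (-4) ^- j) *: 'X^(n - 2 * j).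

Definition T2 : ratfun F -> ratfun F :=
  (@rderiv F \o @rderiv F) \- ((2 * ratX) \*o @rderiv F).

Definition opU b : ratfun F -> ratfun F := @rderiv F \+ *%R (ratC b).

Definition Ahat b : ratfun F -> ratfun F :=
  (T2 \+ *%R (ratC (b ^+ 2))) \- ((ratX + ratC b)^-1 \*o opU b).

Definition T4 b : ratfun F -> ratfun F :=
  (4 \*o ((T2 \+ *%R (ratC (b ^+ 2 - 1))) \o Ahat b))
  \- (3 \*o ((T2 \+ *%R (ratC (b ^+ 2))) \o (T2 \+ *%R (ratC (b ^+ 2 - 2))))).

Definition p2 b : {poly F} := ('X + (b ^+ 2)%:P) * ('X + (b ^+ 2 - 2)%:P).

(* krallS b n is the polynomial of index n + 1 of the family.  For n = 0 the
   last term is 0, whatever the value of hermite n.-1.  The description as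
   (x + b) times Ahat b applied to hermite n is krallSE below. *)
Definition krallS b n : {poly F} :=
  (b ^+ 2 - 2 * n%:R) *: (('X + b%:P) * hermite n)
  - b *: hermite n - n%:R *: hermite n.-1.

End Krall.

Section RderivTheory.
Variable F : fieldType.
Implicit Types (p q : {poly F}) (f g : ratfun F).

Lemma ratpoly_eq p q : (ratpoly p == ratpoly q) = (p == q).
Proof. exact: tofrac_eq. Qed.

Lemma ratpoly_eq0 p : (ratpoly p == 0) = (p == 0).
Proof. exact: tofrac_eq0. Qed.

Lemma ratfun_repr f :
  f = ratpoly \n_(repr f) / ratpoly \d_(repr f) /\ \d_(repr f) != 0.
Proof.
split; last exact: denom_ratioP.
have d0 : ratpoly \d_(repr f) != 0 by rewrite ratpoly_eq0 denom_ratioP.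
apply: (canRL (mulfK d0)); rewrite /ratpoly -{1}[f]reprK.
unlock FracField.tofrac; rewrite -[LHS]FracField.pi_mul.
apply/eqmodP; rewrite /= FracField.equivfE /FracField.mulf.
rewrite !numden_Ratio ?mulf_neq0 ?oner_eq0 ?denom_ratioP //.
by rewrite !mulr1 mulrC.
Qed.

Lemma ratfunP f : exists p q, q != 0 /\ f = ratpoly p / ratpoly q.
Proof.
by have [e d] := ratfun_repr f; exists \n_(repr f), \d_(repr f).
Qed.

Lemma rderiv_frac p q : q != 0 ->
  rderiv (ratpoly p / ratpoly q)
  = ratpoly (p^`() * q - p * q^`()) / ratpoly (q ^+ 2).
Proof.
move=> q0; rewrite /rderiv.
have [] := ratfun_repr (ratpoly p / ratpoly q).
set n := \n_ _; set d := \d_ _ => /eqP e d0.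
have {}e : n * q = p * d.
  apply/eqP; move: e; rewrite eqr_div ?ratpoly_eq0 // -!rmorphM.
  by rewrite ratpoly_eq eq_sym.
have de : n^`() * q + n * q^`() = p^`() * d + p * d^`().
  by rewrite -!derivM e.
apply/eqP; rewrite eqr_div ?ratpoly_eq0 ?expf_neq0 // -!rmorphM.
rewrite ratpoly_eq; apply/eqP.
transitivity (q * d * (n^`() * q + n * q^`()) - d * q^`() * (n * q)
              - q * d^`() * (n * q)); first by ring.
by rewrite de e; ring.
Qed.

Lemma rderiv_poly p : rderiv (ratpoly p) = ratpoly p^`().
Proof.
rewrite -[ratpoly p]divr1 -(rmorph1 (@ratpoly F)) rderiv_frac ?oner_eq0 //.
by rewrite expr1n rmorph1 divr1 derivC mulr0 subr0 mulr1.
Qed.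

Lemma rderivD f g : rderiv (f + g) = rderiv f + rderiv g.
Proof.
have [n1 [e1 [d1 ->]]] := ratfunP f; have [n2 [e2 [d2 ->]]] := ratfunP g.
rewrite addf_div ?ratpoly_eq0 // -!rmorphM -rmorphD.
rewrite !rderiv_frac ?mulf_neq0 // addf_div ?ratpoly_eq0 ?expf_neq0 //.
rewrite -!rmorphM -rmorphD !derivD !derivM exprMn.
by congr (ratpoly _ / _); ring.
Qed.

Lemma rderivM f g : rderiv (f * g) = rderiv f * g + f * rderiv g.
Proof.
have [n1 [e1 [d1 ->]]] := ratfunP f; have [n2 [e2 [d2 ->]]] := ratfunP g.
rewrite mulf_div -!rmorphM !rderiv_frac ?mulf_neq0 //.
rewrite !mulf_div -!rmorphM addf_div ?ratpoly_eq0 ?mulf_neq0 ?expf_neq0 //.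
rewrite -!rmorphM -rmorphD.
apply/eqP; rewrite eqr_div ?ratpoly_eq0 ?mulf_neq0 ?expf_neq0 //.
rewrite -!rmorphM ratpoly_eq !derivM; apply/eqP.
by ring.
Qed.

End RderivTheory.

Section HermiteTheory.
Variable F : numFieldType.
Implicit Types (b : F) (n : nat).

Lemma natr_fact_neq0 n : n`!%:R != 0 :> F.
Proof. by rewrite pnatr_eq0 -lt0n fact_gt0. Qed.

Lemma coef_hermite n i : (hermite F n)`_i =
  if (i <= n)%N && ~~ odd (n - i) then
    n`!%:R / (i`!%:R * ((n - i)./2)`!%:R) * (-4) ^- (n - i)./2
  else 0.
Proof.
rewrite /hermite coef_sum.
under eq_bigr => j _ do rewrite coefZ coefXn.
case: ifP => [/andP[le_in ev]|H].
  have lt : ((n - i)./2 < n./2.+1)%N by rewrite ltnS half_leq // leq_subr.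
  rewrite (bigD1 (Ordinal lt)) //= mul2n even_halfK // subKn // eqxx mulr1.
  rewrite big1 ?addr0 // => j /eqP jn.
  case: eqP => [e|_]; last by rewrite mulr0.
  case: jn; apply: val_inj => /=.
  have le2 : (2 * j <= n)%N.
    by rewrite mul2n -geq_half_double -ltnS.
  by rewrite e subKn // mul2n doubleK.
rewrite big1 // => j _; case: eqP => [e|_]; last by rewrite mulr0.
have le2 : (2 * j <= n)%N by rewrite mul2n -geq_half_double -ltnS.
by move: H; rewrite e leq_subr subKn // mul2n odd_double.
Qed.

Lemma deriv_hermite n : (hermite F n)^`() = n%:R *: hermite F n.-1.
Proof.
apply/polyP => i; rewrite coef_deriv coefZ !coef_hermite.
case: n => [|n]; first by rewrite mul0r mul0rn.
rewrite ltnS subSS /=; case: ifP => _; last by rewrite mul0rn mulr0.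
rewrite -[LHS]mulr_natr !factS !natrM.
have h1 := natr_fact_neq0 (n - i)./2; have h2 := natr_fact_neq0 i.
have h3 : i.+1%:R != 0 :> F by rewrite pnatr_eq0.
rewrite -exprVn; move: (_ ^+ _) i.+1%:R h3 h1 h2 => w a h3.
move: (_`!%:R) (_`!%:R) n.+1%:R n`!%:R => u v x y h1 h2.
by field; rewrite h1 h2 h3.
Qed.

Lemma hermite_ode n :
  (hermite F n)^`()^`() - 2%:R *: ('X * (hermite F n)^`())
  = - (2 * n%:R) *: hermite F n.
Proof.
apply/polyP => i.
rewrite coefB !coefZ coefXM !coef_deriv.
have -> : (if (i == 0)%N then 0 else (hermite F n)`_i.-1.+1 *+ i.-1.+1)
   = (hermite F n)`_i *+ i by case: i => [|i] //=; rewrite mulr0n.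
rewrite !coef_hermite.
have [le_in|lt_ni] := leqP i n; last first.
  have -> : (i.+1 < n)%N = false by rewrite ltnNge (leqW (ltnW lt_ni)).
  by rewrite !mul0rn !mulr0 subr0.
have [|od] := boolP (odd (n - i)) => /=.
  move=> od.
  have -> : (i.+1 < n)%N && ~~ odd (n - i.+2) = false.
    case: ltnP => //= lt; move: od; rewrite !oddB //= negbK.
    by move=> ->.
  by rewrite !mul0rn !mulr0 subr0.
set k := (n - i)./2.
have kn : (n = i + k.*2)%N by rewrite even_halfK // subnKC.
clearbody k; rewrite kn; case: k kn => [|k] kn.
  rewrite addn0 ltnNge leqnSn /= mul0rn mul0rn sub0r.
  by move: (_ / (-4) ^+ 0) => z; rewrite -[z *+ i]mulr_natr; ring.
rewrite doubleS !addnS !ltnS leq_addr /= !subSS addKn odd_double /= doubleK.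
rewrite -[X in X *+ _ - _]mulr_natr -[X in X - _]mulr_natr.
rewrite -[X in _ - _ * X]mulr_natr.
rewrite [i.+2`!]factS [i.+1`!]factS [k.+1`!]factS !natrM -!exprVn exprS.
have -> : (i + k.*2).+2%:R = i%:R + 2 * k.+1%:R :> F.
  by rewrite -natrM mul2n -natrD doubleS !addnS.
have h1 := natr_fact_neq0 k; have h2 := natr_fact_neq0 i.
have h3 : i.+1%:R != 0 :> F by rewrite pnatr_eq0.
have h4 : i.+2%:R != 0 :> F by rewrite pnatr_eq0.
have h5 : k.+1%:R != 0 :> F by rewrite pnatr_eq0.
move: (_ ^+ k) (_`!%:R) (_`!%:R) (_`!%:R) i%:R i.+1%:R i.+2%:R k.+1%:R
  (i + k.*2).+1%:R h1 h2 h3 h4 h5 => w u v y x a c d z h1 h2 h3 h4 h5.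
by field; rewrite h1 h2 h3 h4 h5.
Qed.

Lemma krallSE b n :
  ratpoly (krallS b n)
  = (ratX + ratC b) * Ahat b (ratpoly (hermite F n)).
Proof.
have nz : ratX + ratC b != 0.
  by rewrite -rmorphD ratpoly_eq0 -size_poly_eq0 size_XaddC.
rewrite /Ahat /= /T2 /opU /= !rderiv_poly.
rewrite [in RHS]mulrBr mulrA mulfV // mul1r.
have -> : (2 : ratfun F) = ratpoly 2%:R%:P.
  by rewrite polyC_natr rmorph_nat.
rewrite /ratX /ratC -!(rmorphM, rmorphD, rmorphB); congr ratpoly.
have := hermite_ode n; rewrite -mul_polyC -mulrA => ->.
rewrite /krallS deriv_hermite -!mul_polyC.
by rewrite !(polyCB, polyCN, polyCM, polyCD); ring.
Qed.

End HermiteTheory.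

(* Main.v *)
Require Import Defs.
From HB Require Import structures.
From mathcomp Require Import all_boot all_order all_algebra.
From mathcomp Require Import reals complex.
From mathcomp Require Import ring.
Import GRing.Theory Num.Theory.
Local Open Scope ring_scope.

(** Composing the second-order factors gives [T4 b] in the normal form
    [d^4 - 4 (x + w) d^3 + a2 d^2 + a1 d + a0], where [w = 1 / (x + b)].  By the
    Hermite equation [h'' = 2 x h' - 2 n h], every derivative of the Krall
    polynomial [(b^2 - 2 n) (x + b) h - b h - h'] is a combination of [h] and
    [h'] with polynomial coefficients, so the eigenvalue equation becomes an
    identity between the coefficients of [h] and [h'] in F(x). *)

(** * Calculus in a field with a derivation *)

Section Derivation.
Variables (K : fieldType) (D : K -> K).
Hypothesis derD : forall f g, D (f + g) = D f + D g.
Hypothesis derM : forall f g, D (f * g) = D f * g + f * D g.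
Implicit Types (c m x f g : K).

Lemma der1 : D 1 = 0.
Proof.
by apply: (@addrI _ (D 1)); rewrite addr0 -[in RHS](mulr1 1) derM mulr1 mul1r.
Qed.

Lemma der0 : D 0 = 0.
Proof. by apply: (@addrI _ (D 0)); rewrite -derD !addr0. Qed.

Lemma derN f : D (- f) = - D f.
Proof. by apply: (@addrI _ (D f)); rewrite -derD !subrr der0. Qed.

Lemma derV f : f != 0 -> D f^-1 = - D f * f^-1 ^+ 2.
Proof.
move=> f0; have := derM f f^-1.
rewrite mulfV // der1 => /esym/eqP.
rewrite addrC addr_eq0 => /eqP e; apply: (mulfI f0).
by rewrite e; field.
Qed.

(** The operators over any field with a derivation [D], with [x] and [c] standing for [ratX] and
    [ratC b], so that the identities below involve only abstract variables. *)
Definition krall_T2 x f := D (D f) - 2 * x * D f.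

Definition krall_A x c f :=
  krall_T2 x f + c ^+ 2 * f - (x + c)^-1 * (D f + c * f).

Definition krall_T4 x c f :=
  4 * (krall_T2 x (krall_A x c f) + (c ^+ 2 - 1) * krall_A x c f)
  - 3 * (krall_T2 x (krall_T2 x f + (c ^+ 2 - 2) * f)
         + c ^+ 2 * (krall_T2 x f + (c ^+ 2 - 2) * f)).

(** Write [krall_A] as D^2 + p D + q with p = -(2 x + w) and q = c^2 - c w. Since w' = -w^2, one has
    p' = w^2 - 2 and q' = c w^2. The terms with factor 4 and those with factor 3 come from the two
    compositions in [krall_T4]. *)
Definition krall_coef2 x c :=
  let w := (x + c)^-1 in
  4 * (2 * (w ^+ 2 - 2) + 2 * c ^+ 2 - 1 - c * w + 2 * x * (2 * x + w))
  - 3 * (4 * x ^+ 2 + 2 * c ^+ 2 - 6).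

Definition krall_coef1 x c :=
  let w := (x + c)^-1 in
  4 * (2 * c * w ^+ 2 - 2 * w ^+ 3 - 2 * x * (w ^+ 2 - 2 + c ^+ 2 - c * w)
       - (c ^+ 2 - 1) * (2 * x + w))
  - 3 * (8 * x - 4 * x * c ^+ 2).

Definition krall_coef0 x c :=
  let w := (x + c)^-1 in
  4 * ((c ^+ 2 - 1) * (c ^+ 2 - c * w) - 2 * c * w ^+ 3 - 2 * x * c * w ^+ 2)
  - 3 * c ^+ 2 * (c ^+ 2 - 2).

Variables x c : K.
Hypothesis derx : D x = 1.
Hypothesis derc : D c = 0.
Hypothesis xc_neq0 : x + c != 0.

Lemma krall_T4E f :
  krall_T4 x c f = D (D (D (D f))) - 4 * (x + (x + c)^-1) * D (D (D f))
    + (krall_coef2 x c * D (D f) + krall_coef1 x c * D f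
       + krall_coef0 x c * f).
Proof.
have derw : D (x + c)^-1 = - (x + c)^-1 ^+ 2.
  by rewrite derV // derD derx derc addr0 mulN1r.
rewrite /krall_T4 /krall_A /krall_T2 /krall_coef2 /krall_coef1 /krall_coef0.
(* From here w is an atom with derivative -w^2. *)
move: (_^-1) derw => w derw.
rewrite !(derD, derN, derM, derw, derx, derc, der1, der0, expr2).
by ring.
Qed.

(** Here [g] stands for h_n and [m] for n, with D g in place of n h_{n-1}; the eigenvalue is p2(-2
    m). *)
Lemma krall_T4_eigen m g :
    D m = 0 -> D (D g) = 2 * x * D g - 2 * m * g ->
  let k := (c ^+ 2 - 2 * m) * ((x + c) * g) - c * g - D g in
  krall_T4 x c k = (c ^+ 2 - 2 * m) * (c ^+ 2 - 2 - 2 * m) * k.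
Proof.
move=> derm Dg k; rewrite krall_T4E /k {k}.
rewrite /krall_coef2 /krall_coef1 /krall_coef0.
set h := D g in Dg *.
(* The Hermite equation makes the span of g and h = D g stable under [D]; [Dcomb] is the action on
   coefficient pairs. *)
pose comb u v := u * g + v * h.
have Dcomb u v : D (comb u v)
    = comb (D u - 2 * m * v) (u + D v + 2 * x * v).
  by rewrite /comb derD !derM Dg -/h; ring.
(* An opaque constant N keeps the coefficients short until [eN] unfolds it at the end. *)
have [N eN] : exists N, N = c ^+ 2 - 2 * m by eexists.
have derN0 : D N = 0.
  by rewrite eN expr2 !(derD, derN, derM) derc derm der1; ring.
have -> : (c ^+ 2 - 2 * m) * ((x + c) * g) - c * g - h
    = comb (N * (x + c) - c) (-1) by rewrite /comb eN; ring.
have -> : D (comb (N * (x + c) - c) (-1))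
    = comb (N + 2 * m) (N * (x + c) - c - 2 * x).
  rewrite Dcomb !(derD, derN, derM) derN0 derx derc der1.
  by congr comb; ring.
have -> : D (comb (N + 2 * m) (N * (x + c) - c - 2 * x))
    = comb (- 2 * m * (N * (x + c) - c - 2 * x))
        (2 * N + 2 * m - 2 + 2 * x * (N * (x + c) - c - 2 * x)).
  rewrite Dcomb !(derD, derN, derM, derN0, derx, derc, derm, der1).
  by congr comb; ring.
rewrite !Dcomb.
rewrite !(derD, derN, derM, derN0, derx, derc, derm, der1, der0).
(* With g and h as independent variables, what remains is a rational identity whose denominators are
   powers of x + c. *)
rewrite /comb eN; clearbody h.
by field.
Qed.

End Derivation.

Arguments krall_T4 {K} D x c f.
Arguments krall_coef2 {K} x c.
Arguments krall_coef1 {K} x c.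
Arguments krall_coef0 {K} x c.

(** * Transfer to the field F(x) *)

Section Expansion.
Variable F : fieldType.
Implicit Types (b c d : F) (f : ratfun F).
Local Notation D := (@rderiv F).

Lemma ratXC_neq0 b : ratX + ratC b != 0.
Proof. by rewrite -rmorphD ratpoly_eq0 -size_poly_eq0 size_XaddC. Qed.

Lemma rderivC c : D (ratC c) = 0.
Proof. by rewrite rderiv_poly derivC rmorph0. Qed.

Lemma rderivX : D ratX = 1.
Proof. by rewrite rderiv_poly derivX rmorph1. Qed.

Lemma ratC_exp c k : ratC (c ^+ k) = ratC c ^+ k.
Proof. by rewrite /ratC polyC_exp rmorphXn. Qed.

Lemma ratCM c d : ratC (c * d) = ratC c * ratC d.
Proof. by rewrite /ratC polyCM rmorphM. Qed.

Lemma ratCB_nat c k : ratC (c - k%:R) = ratC c - k%:R.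
Proof. by rewrite /ratC polyCB rmorphB polyC_natr rmorph_nat. Qed.

Lemma T4_krall_T4 b f : T4 b f = krall_T4 D ratX (ratC b) f.
Proof.
rewrite /T4 /Ahat /T2 /opU /=.
by rewrite (ratCB_nat _ 1) (ratCB_nat _ 2) ratC_exp.
Qed.

Lemma T4E b f :
  T4 b f = D (D (D (D f))) - 4 * (ratX + (ratX + ratC b)^-1) * D (D (D f))
    + (krall_coef2 ratX (ratC b) * D (D f)
       + krall_coef1 ratX (ratC b) * D f + krall_coef0 ratX (ratC b) * f).
Proof.
rewrite T4_krall_T4.
exact: (krall_T4E _ _ (@rderivD F) (@rderivM F) _ _ rderivX (rderivC b)
          (ratXC_neq0 b)).
Qed.

Lemma T4_order2_part b : diffop_order_le 2
  (fun f => krall_coef2 ratX (ratC b) * D (D f)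
     + krall_coef1 ratX (ratC b) * D f + krall_coef0 ratX (ratC b) * f).
Proof.
(* Entry i multiplies the i-th derivative, so the list starts at order 0. *)
exists (fun i => [:: krall_coef0 ratX (ratC b); krall_coef1 ratX (ratC b);
                     krall_coef2 ratX (ratC b)]`_i) => f.
by rewrite !big_ord_recl big_ord0 /= addr0 addrC; congr (_ + _); rewrite addrC.
Qed.

End Expansion.

(** This is [krall_T4_eigen] at g = h_n and m = n, since h_n' = n h_{n-1}, both sides being 0 for n
    = 0. *)
Lemma T4_krallS (F : numFieldType) (b : F) n :
  T4 b (ratpoly (krallS b n))
  = ratC ((b ^+ 2 - 2 * n%:R) * (b ^+ 2 - 2 - 2 * n%:R))
    * ratpoly (krallS b n).
Proof.
have E (c d : F) : ratC (c - 2 * d) = ratC c - 2 * ratC d.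
  by rewrite /ratC polyCB polyCM !(rmorphB, rmorphM) polyC_natr rmorph_nat.
have -> : ratpoly (krallS b n)
    = (ratC b ^+ 2 - 2 * ratC n%:R)
        * ((ratX + ratC b) * ratpoly (hermite F n))
      - ratC b * ratpoly (hermite F n) - rderiv (ratpoly (hermite F n)).
  rewrite rderiv_poly deriv_hermite -ratC_exp -E.
  by rewrite /krallS /ratC /ratX -!mul_polyC !(rmorphB, rmorphM, rmorphD).
rewrite T4_krall_T4 (krall_T4_eigen _ _ (@rderivD F) (@rderivM F) _ _ (rderivX F)
  (rderivC F b) (ratXC_neq0 F b) (ratC n%:R)) ?rderivC //.
  by rewrite ratCM !E (ratCB_nat _ _ 2) ratC_exp.
(* The remaining premise is the Hermite equation, carried from polynomials to F(x). *)
rewrite !rderiv_poly; have /eqP := hermite_ode F n.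
rewrite subr_eq => /eqP ->; rewrite scaleNr addrC -!mul_polyC polyCM.
rewrite rmorphB !rmorphM -!/(ratpoly _) -/ratX -/(ratC _).
by rewrite polyC_natr rmorph_nat mulrA.
Qed.

Theorem proposition2p2 (R : realType) (b : R[i]) :
  (exists2 L : ratfun R[i] -> ratfun R[i],
     diffop_order_le 2 L &
     forall f : ratfun R[i],
       T4 b f = iter 4 (@rderiv R[i]) f
                - 4 * (ratX + (ratX + ratC b)^-1) * iter 3 (@rderiv R[i]) f
                + L f)
  /\ (forall n : nat,
       T4 b (ratpoly (krallS b n))
         = ratC (p2 b).[- (2 * n%:R)] * ratpoly (krallS b n)
       /\ ratC (p2 b).[- (2 * n%:R)] * ratpoly (krallS b n)
         = ratC ((b ^+ 2 - 2 * n%:R) * (b ^+ 2 - 2 - 2 * n%:R))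
           * ratpoly (krallS b n)).
Proof.
split; first by eexists; [exact: T4_order2_part | exact: T4E].
move=> n; have -> : (p2 b).[- (2 * n%:R)]
    = (b ^+ 2 - 2 * n%:R) * (b ^+ 2 - 2 - 2 * n%:R).
  by rewrite /p2 hornerM !hornerD !hornerC !hornerX ![- _ + _]addrC.
by rewrite T4_krallS.
Qed.
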